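(* Let $A$ be a ring with $A^*$ finite and $\epsilon(A)=2$, and let $p$ be a prime with $p\equiv 3\pmod 4$. Then for each $j\ge 1$ the quotient group $(1+\mathfrak{N}_p^j)/(1+\mathfrak{N}_p^{j+1})$ has a (finite) filtration by subgroups such that all its successive quotients are $\mathbb{F}_{p^2}$-vector spaces (i.e. are isomorphic, as groups, to additive groups of $\mathbb{F}_{p^2}$-vector spaces). In particular, $|1+\mathfrak{N}_p|$ is a perfect square.
   Context: Rings are commutative with $1\ne 0$. $A^*$ denotes the multiplicative group of invertible elements of $A$, and $\mathfrak{N}$ is the nilradical of $A$ (the ideal of nilpotent elements), which is finite when $A^*$ is finite since $1+\mathfrak N\subseteq A^*$. $\mathfrak{N}_p$ is the $p$-Sylow subgroup of the additive group of $\mathfrak{N}$; it is an ideal of $A$, $\mathfrak{N}_p^j$ denotes its $j$-th power as an ideal, and $1+\mathfrak{N}_p^j=\{1+x : x\in\mathfrak{N}_p^j\}$ is a subgroup of $A^*$. For a ring $A$ with $A^*$ finite of even order, write the 2-Sylow subgroup of $A^*$ as a direct sum of nontrivial cyclic groups $\mathbb{Z}/2^{e_1}\mathbb{Z}\oplus\dots\oplus\mathbb{Z}/2^{e_s}\mathbb{Z}$ with all $e_i\ge 1$; then $\epsilon(A):=\min_i e_i$. *)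

(* Defs.v *)
From HB Require Import structures.
From mathcomp Require Import all_boot all_order all_algebra all_fingroup.
From mathcomp Require Import all_solvable.
From mathcomp Require Import boolp classical_sets cardinality.

Set Implicit Arguments.
Unset Strict Implicit.
Unset Printing Implicit Defensive.

Import GRing.Theory GroupScope.
Local Open Scope ring_scope.

Definition finitely_many_units (A : comUnitRingType) : Prop :=
  finite_set [set u : A | u \is a GRing.unit]%classic.

Section EnumSub.
Variables (T : choiceType) (P : pred T) (S : subChoiceType P).
Hypothesis finS : finite_set [set x : T | P x]%classic.

Lemma enum_sub_subproof : exists s : seq S, Finite.axiom s.
Proof.
have /finite_seqP[s sE] := finS.
exists (undup (pmap (insub : T -> option S) s)).
apply: Finite.uniq_enumP; first exact: undup_uniq.
move=> x; rewrite mem_undup mem_pmap_sub.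
have : [set x : T | P x]%classic (val x) by exact: valP.
by rewrite sE.
Qed.

Definition enum_sub : seq S := sval (cid enum_sub_subproof).

Lemma enum_subP : Finite.axiom enum_sub.
Proof. exact: svalP (cid enum_sub_subproof). Qed.

Definition enum_sub_pickle (x : S) : nat := index x enum_sub.
Definition enum_sub_unpickle (n : nat) : option S :=
  nth None (map some enum_sub) n.
Lemma enum_sub_pickleK : pcancel enum_sub_pickle enum_sub_unpickle.
Proof.
move=> x; rewrite /enum_sub_unpickle /enum_sub_pickle.
rewrite -(index_map Some_inj) nth_index ?map_f//.
by apply/count_memPn=> /eqP; rewrite enum_subP.
Qed.

End EnumSub.

(* A^* as a finite group. The library's {unit R} requires R itself to be      *)
(* finite; here the finiteness proof is an argument of the type, so that it   *)
(* can carry the finType structure.                                           *)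
Record unit_group (A : comUnitRingType) (finU : finitely_many_units A) :=
  UnitGroup { unit_val :> A; _ : unit_val \is a GRing.unit }.

Section UnitGroup.
Variables (A : comUnitRingType) (finU : finitely_many_units A).
Local Notation U := (unit_group finU).

HB.instance Definition _ := [isSub for @unit_val A finU].
HB.instance Definition _ := [Choice of U by <:].
HB.instance Definition _ :=
  Choice_isCountable.Build U (@enum_sub_pickleK _ _ U finU).
HB.instance Definition _ := isFinite.Build U (@enum_subP _ _ U finU).

Lemma unit_group1_subproof : (1 : A) \is a GRing.unit.
Proof. exact: unitr1. Qed.
Lemma unit_groupM_subproof (u v : U) : val u * val v \is a GRing.unit.
Proof. by rewrite unitrMl; [exact: valP u | exact: valP v]. Qed.
Lemma unit_groupV_subproof (u : U) : (val u)^-1 \is a GRing.unit.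
Proof. by rewrite unitrV; exact: valP u. Qed.

Definition unit_group_one : U := UnitGroup finU unit_group1_subproof.
Definition unit_group_mul (u v : U) : U :=
  UnitGroup finU (unit_groupM_subproof u v).
Definition unit_group_inv (u : U) : U :=
  UnitGroup finU (unit_groupV_subproof u).

Lemma unit_group_mulA : associative unit_group_mul.
Proof. by move=> u v w; apply/val_inj/mulrA. Qed.
Lemma unit_group_mul1 : left_id unit_group_one unit_group_mul.
Proof. by move=> u; apply/val_inj/mul1r. Qed.
Lemma unit_group_mulV :
  left_inverse unit_group_one unit_group_inv unit_group_mul.
Proof. by move=> u; apply/val_inj/mulVr/(valP u). Qed.

HB.instance Definition _ := Finite_isGroup.Build U
  unit_group_mulA unit_group_mul1 unit_group_mulV.

Lemma unit_group_abelian (G : {group U}) : abelian G.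
Proof.
by apply/centsP => u _ v _; apply/val_inj/mulrC.
Qed.

End UnitGroup.

Lemma unit_group_Sylow (A : comUnitRingType) (finU : finitely_many_units A)
    (p : nat) : p.-Sylow([set: unit_group finU]) 'O_p([set: unit_group finU]).
Proof. exact/nilpotent_pcore_Hall/abelian_nil/unit_group_abelian. Qed.

(* has_epsilon finU n: the 2-Sylow subgroup of A^* is a direct sum of         *)
(* nontrivial cyclic groups <x_i> of orders 2 ^ e_i, and n = min_i e_i. An    *)
(* attained minimum forces the family to be nonempty, i.e. #|A^*| to be even. *)
Definition has_epsilon (A : comUnitRingType) (finU : finitely_many_units A)
    (n : nat) : Prop :=
  exists (s : nat) (x : 'I_s -> unit_group finU) (e : 'I_s -> nat),
    [/\ (\big[dprod/1]_(i < s) <[x i]>)%g = 'O_2([set: unit_group finU])%g,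
        forall i, #[x i]%g = (2 ^ e i)%N /\ (1 <= e i)%N,
        exists i, e i = n
      & forall i, (n <= e i)%N].

Definition nilpotent_elt (A : comUnitRingType) : pred A :=
  fun x => `[< exists n : nat, x ^+ n = 0 >].

Lemma nilpotentP (A : comUnitRingType) (x : A) :
  reflect (exists n : nat, x ^+ n = 0) (x \in @nilpotent_elt A).
Proof. exact: asboolP. Qed.

Lemma nilpotent_zmod_closed (A : comUnitRingType) :
  zmod_closed (@nilpotent_elt A).
Proof.
split=> [|x y /nilpotentP[m xm] /nilpotentP[n yn]].
  by apply/nilpotentP; exists 1%N; rewrite expr1.
apply/nilpotentP; exists (m + n)%N; rewrite exprBn big1 // => i _.
have [lt_in|le_ni] := ltnP i n.
  rewrite (_ : (m + n - i)%N = m + (n - i))%N; last by rewrite addnBA ?(ltnW lt_in).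
  by rewrite exprD xm mul0r mulr0 mul0r mul0rn.
by rewrite -(subnKC le_ni) [y ^+ _]exprD yn mul0r mulr0 mul0rn.
Qed.

Lemma unit_1_nilpotent (A : comUnitRingType) (x : A) :
  x \in @nilpotent_elt A -> 1 + x \is a GRing.unit.
Proof.
move=> /nilpotentP[n xn].
have e : (1 + x) * (\sum_(i < n) (- x) ^+ i) = 1.
  have := subrX1 (- x) n; rewrite exprNn xn mulr0 sub0r => e.
  by apply: oppr_inj; rewrite e -mulNr opprD addrC.
by apply/unitrPr; exists (\sum_(i < n) (- x) ^+ i).
Qed.

HB.instance Definition _ (A : comUnitRingType) :=
  GRing.isZmodClosed.Build A (@nilpotent_elt A) (@nilpotent_zmod_closed A).

Lemma finite_nilpotent (A : comUnitRingType) (finU : finitely_many_units A) :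
  finite_set [set x : A | @nilpotent_elt A x]%classic.
Proof.
pose f (x : A) := 1 + x.
apply: sub_finite_set (finite_preimage (f := f) _ finU) => [x /= nx|].
  exact: unit_1_nilpotent.
by move=> x y _ _ /addrI.
Qed.

(* The nilradical of A as a finite additive group. *)
Record nilradical (A : comUnitRingType) (finU : finitely_many_units A) :=
  Nilradical { nil_val :> A; _ : @nilpotent_elt A nil_val }.

Section Nilradical.
Variables (A : comUnitRingType) (finU : finitely_many_units A).
Local Notation N := (nilradical finU).

HB.instance Definition _ := [isSub for @nil_val A finU].
HB.instance Definition _ := [Choice of N by <:].
HB.instance Definition _ := Choice_isCountable.Build N
  (@enum_sub_pickleK _ _ N (finite_nilpotent finU)).
HB.instance Definition _ := isFinite.Build N
  (@enum_subP _ _ N (finite_nilpotent finU)).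
HB.instance Definition _ := GRing.SubChoice_isSubZmodule.Build A _ N
  (@nilpotent_zmod_closed A).
HB.instance Definition _ := [finGroupMixin of N for +%R].

Lemma nilradical_abelian (G : {group N}) : abelian G.
Proof. by apply/centsP => x _ y _; exact: addrC. Qed.

End Nilradical.

Lemma nilradical_Sylow (A : comUnitRingType) (finU : finitely_many_units A)
    (p : nat) : p.-Sylow([set: nilradical finU]) 'O_p([set: nilradical finU]).
Proof. exact/nilpotent_pcore_Hall/abelian_nil/nilradical_abelian. Qed.

(* The p-Sylow subgroup of the additive group of the nilradical, in A. *)
Definition nilradical_p (A : comUnitRingType) (finU : finitely_many_units A)
    (p : nat) : set A :=
  fun z => exists2 x : nilradical finU,
    x \in 'O_p([set: nilradical finU]) & nil_val x = z.

Definition ideal_mul (A : comUnitRingType) (I J : set A) : set A :=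
  [set z | exists (n : nat) (x y : 'I_n -> A),
      (forall i, I (x i) /\ J (y i)) /\ z = \sum_(i < n) x i * y i]%classic.

Fixpoint ideal_pow (A : comUnitRingType) (I : set A) (j : nat) : set A :=
  if j is k.+1 then ideal_mul I (ideal_pow I k) else setT.

(* 1 + I, as a subset of A^*; every 1 + x with x nilpotent is a unit.         *)
Definition one_plus (A : comUnitRingType) (finU : finitely_many_units A)
    (I : set A) : {set unit_group finU} :=
  [set u | `[< exists2 x, I x & unit_val u = 1 + x >]].

Lemma one_plusP (A : comUnitRingType) (finU : finitely_many_units A)
    (I : set A) (u : unit_group finU) :
  reflect (exists2 x, I x & unit_val u = 1 + x) (u \in one_plus finU I).
Proof. by rewrite inE; exact: asboolP. Qed.

Lemma ideal_powD (A : comUnitRingType) (I : set A) (j : nat) (x y : A) :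
  ideal_pow I j x -> ideal_pow I j y -> ideal_pow I j (x + y).
Proof.
case: j => [//|j] [m [a [b [ab ->]]]] [n [c [d [cd ->]]]].
exists (m + n)%N, (fun i => match split i with inl k => a k | inr k => c k end),
  (fun i => match split i with inl k => b k | inr k => d k end); split.
  by move=> i; case: (split i).
rewrite big_split_ord /=; congr (_ + _); apply: eq_bigr => i _.
  by rewrite (unsplitK (inl i : 'I_m + 'I_n)).
by rewrite (unsplitK (inr i : 'I_m + 'I_n)).
Qed.

Lemma ideal_pow0 (A : comUnitRingType) (I : set A) (j : nat) : ideal_pow I j 0.
Proof.
case: j => [//|j]; exists 0%N, (fun=> 0), (fun=> 0).
by rewrite big_ord0; split=> [[]|].
Qed.

Lemma ideal_powM (A : comUnitRingType) (I : set A) (j : nat) (a x : A) :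
  ideal_pow I j x -> ideal_pow I j (a * x).
Proof.
elim: j a x => [//|j IH] a x [n [b [c [bc ->]]]].
exists n, b, (fun i => a * c i); split.
  by move=> i; have [? ?] := bc i; split=> //; exact: IH.
by rewrite mulr_sumr; apply: eq_bigr => i _; rewrite mulrCA.
Qed.

Lemma one_plus_pow_group_set (A : comUnitRingType)
    (finU : finitely_many_units A) (I : set A) (j : nat) :
  group_set (one_plus finU (ideal_pow I j)).
Proof.
apply/group_setP; split=> [|u v].
  apply/one_plusP; exists 0; first exact: ideal_pow0.
  by rewrite addr0.
move=> /one_plusP[x Ix ux] /one_plusP[y Iy vy].
apply/one_plusP; exists (x + (y + x * y)).
  by apply: ideal_powD => //; apply: ideal_powD => //; exact: ideal_powM.
have -> : unit_val (u * v)%g = unit_val u * unit_val v by [].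
by rewrite ux vy mulrDl mul1r mulrDr mulr1 -addrA [y + (_ + _)]addrCA.
Qed.

Canonical one_plus_pow_group (A : comUnitRingType)
    (finU : finitely_many_units A) (I : set A) (j : nat) :=
  Group (one_plus_pow_group_set finU I j).

(* Q is isomorphic to the additive group of a vector space over F_(p^2);      *)
(* a finLmodType is a finGroupType for its addition.                          *)
Definition is_Fp2_space (p : nat) (gT : finGroupType) (Q : {set gT}) : Prop :=
  exists (F : finFieldType) (V : finLmodType F),
    #|F| = (p ^ 2)%N /\ Q \isog [set: V].

Definition has_Fp2_filtration (p : nat) (gT : finGroupType)
    (Q : {set gT}) : Prop :=
  exists (n : nat) (H : nat -> {group gT}),
    [/\ H 0%N :=: 1%g, H n :=: Q
      & forall i, (i < n)%N ->
          H i <| H i.+1 /\ is_Fp2_space p (H i.+1 / H i)%g].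

(* Main.v *)
Require Import Defs.
From mathcomp Require Import boolp classical_sets.
From mathcomp Require Import all_boot all_algebra all_fingroup.
From mathcomp Require Import all_solvable all_field.
From mathcomp Require Import ring.

(** Why the theorem holds.

The hypothesis epsilon(A) = 2 enters once. All cyclic factors of the 2-Sylow
subgroup of A^* then have order divisible by 4, so every element of order at
most 2 is a square ([bigdprod_sqrt]); this applies to -1, so A contains some i
with i ^ 2 = -1 ([sqrtN1]), that is, A is an algebra over the Gaussian
integers Z[i]. As p = 3 mod 4, the prime p is inert in Z[i] and Z[i] / p is the
field with p ^ 2 elements. Every finite p-group that is a Z[i]-module is
therefore filtered, by the powers of p, with quotients that are spaces over
that field.

The action of Z[i] on a p-group is used only through the map f, multiplication
by i, with f (f x) = x^-1, and the field structure only through a count. Since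
p is odd, f generates an action of the cyclic group of order 4 that is free
away from 1, so the group has order 1 mod 4 ([card_free_C4]); a power p ^ k
with p = 3 mod 4 is 1 mod 4 only when k is even ([card_pgroup_sqrtN1]). This
holds for every f-stable subgroup, in particular for all terms of the series of
p ^ k-th powers, whose successive quotients are thus elementary abelian of
order an even power of p ([Fp2_filtration_sqrtN1]). An elementary abelian group
is determined by its order, so each quotient is isomorphic to the additive
group of a space over the field with p ^ 2 elements ([abelem_Fp2_space]).

It remains to let i act. Write I for the p-part of the nilradical. On the
additive group of I the action is multiplication, which gives the order of
1 + I directly ([card_one_plus_square]). On (1 + I^j) / (1 + I^(j+1)) with
j >= 1 it is 1 + x |-> 1 + i x: this map does not respect products in 1 + I^j,
but its defects are multiples of products of two elements of I^j, and those lie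
in I^(j+1) ([coset_twistM], [coset_twist2]). *)

Set Implicit Arguments.
Unset Strict Implicit.
Unset Printing Implicit Defensive.

Import GRing.Theory.
Local Open Scope group_scope.

(** * Finite p-groups with a square root of inversion *)

(** The map [f] generates an action of the cyclic group of order 4 on [S] whose
    only non-free orbit is the fixed point [x0]; all other orbits have exactly
    four elements. The proof removes these orbits one at a time. *)
Lemma card_free_C4 (T : finType) (S : {set T}) (f : T -> T) (x0 : T) :
    x0 \in S -> {in S, forall x, f x \in S} ->
    {in S, forall x, f (f (f (f x))) = x} -> f x0 = x0 ->
    {in S, forall x, f (f x) = x -> x = x0} ->
  #|S| = 1 %[mod 4].
Proof.
have [n leSn] := ubnP #|S|; elim: n => // n IHn in S leSn *.
move=> Sx0 fS f4 f0 free.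
have [sS|] := boolP (S \subset [set x0]).
  by have /eqP-> : S == [set x0]; rewrite ?cards1 // eqEsubset sS sub1set.
case/subsetPn=> x Sx; rewrite inE => x'0.
have f2n y : y \in S -> y != x0 -> f (f y) != y.
  by move=> Sy; apply: contra => /eqP /(free _ Sy) ->.
have f1n y : y \in S -> y != x0 -> f y != y.
  move=> Sy /(f2n _ Sy); apply: contra => /eqP fy.
  by rewrite !fy.
have fn0 y : y \in S -> y != x0 -> f y != x0.
  by move=> Sy; apply: contra => /eqP fy; rewrite -(f4 y Sy) fy !f0.
pose O := [set x; f x; f (f x); f (f (f x))].
have sOS : O \subset S.
  by apply/subsetP=> y; rewrite !inE -!orbA => /or4P[] /eqP->; rewrite ?fS.
have cO : #|O| = 4.
  have Sf := fS _ Sx; have Sff := fS _ Sf.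
  have nf := fn0 _ Sx x'0; have nff := fn0 _ Sf nf.
  rewrite /O -!setUA !cardsU1 cards1 !inE.
  rewrite ![_ == f (f x)]eq_sym ![_ == f (f (f x))]eq_sym [x == f x]eq_sym.
  rewrite (negPf (f1n _ Sx x'0)) (negPf (f1n _ Sf nf)) (negPf (f1n _ Sff nff)).
  rewrite (negPf (f2n _ Sx x'0)) (negPf (f2n _ Sf nf)).
  suff /negPf-> : f (f (f x)) != x by [].
  apply: contra (f1n _ Sx x'0) => /eqP fffx.
  by rewrite -{1}fffx f4.
(* The complement of an orbit is again stable under [f]. *)
have inO y : y \in S -> f y \in O -> y \in O.
  move=> Sy; rewrite !inE -!orbA => /or4P[] /eqP fy.
  - by rewrite -(f4 y Sy) fy !eqxx !orbT.
  - by rewrite -(f4 y Sy) fy f4 // eqxx.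
  - by rewrite -(f4 y Sy) fy f4 ?fS // eqxx !orbT.
  by rewrite -(f4 y Sy) fy f4 ?fS // eqxx !orbT.
have := cardsID O S; rewrite (setIidPr sOS) cO => cS.
rewrite -cS addnC modnDr; apply: IHn => //.
- by rewrite -ltnS (leq_trans _ leSn) // ltnS -cS addnC -addn1 leq_add2l.
- rewrite inE Sx0 andbT; apply/negP; rewrite !inE -!orbA.
  have Sf := fS _ Sx; have nf := fn0 _ Sx x'0.
  have Sff := fS _ Sf; have nff := fn0 _ Sf nf.
  case/or4P=> /eqP e0; first by rewrite e0 eqxx in x'0.
  + by rewrite -e0 eqxx in nf.
  + by rewrite -e0 eqxx in nff.
  by move: (fn0 _ Sff nff); rewrite -e0 eqxx.
- by move=> y /setDP[Sy nOy]; rewrite inE fS // (contra (inO y Sy)).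
- by move=> y /setDP[Sy _]; exact: f4.
by move=> y /setDP[Sy _]; exact: free.
Qed.

Section InertPrime.
Variable p : nat.
Hypotheses (pr_p : prime p) (p3 : p = 3 %[mod 4]).

Lemma prime3mod4_odd : odd p.
Proof. by rewrite (divn_eq p 4) p3 oddD oddM andbF. Qed.

(** Modulo 4, [p] is [-1]. *)
Lemma expn3mod4 n : p ^ n = 1 %[mod 4] -> ~~ odd n.
Proof.
rewrite -modnXm p3 modnXm -(odd_double_half n) expnD -mul2n expnM.
rewrite -modnMmr -modnXm exp1n oddD mul2n odd_double addbF.
by case: (odd n).
Qed.

(** A fixed point of [f \o f] equals its own inverse, hence is trivial because
    [p] is odd; so [card_free_C4] applies, and a power of [p] that is 1 mod 4
    has an even exponent. *)
Lemma card_pgroup_sqrtN1 (gT : finGroupType) (G : {group gT}) (f : gT -> gT) :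
    p.-group G -> {in G, forall x, f x \in G} ->
    {in G, forall x, f (f x) = x^-1} ->
  exists m, #|G| = (p ^ (2 * m))%N.
Proof.
move=> pG fG f2.
have inv1 x : x \in G -> x = x^-1 -> x = 1.
  move=> Gx xV; apply/eqP; rewrite -order_eq1 -dvdn1.
  have x2 : x ^+ 2 = 1 by rewrite expgS expg1 {2}xV mulgV.
  have co2x : coprime 2 #[x].
    case/p_natP: (mem_p_elt pG Gx) => k ->.
    by rewrite coprime2n oddX prime3mod4_odd orbT.
  by rewrite -(eqP co2x) dvdn_gcd order_dvdn x2 eqxx /=.
have f41 : #|G| = 1 %[mod 4].
  have free x : x \in G -> f (f x) = x -> x = 1.
    by move=> Gx; rewrite f2 // => /esym; exact: inv1.
  apply: (card_free_C4 (group1 G) fG) => //.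
    by move=> x Gx; rewrite f2 ?fG // f2 // invgK.
  by apply: free; rewrite ?fG // [f (f 1)]f2 // invg1.
have [k ck] := p_natP pG; exists k./2; rewrite mul2n ck.
rewrite -[in LHS](odd_double_half k) (negPf (expn3mod4 _)) //.
by rewrite -ck.
Qed.

(** An elementary abelian group is determined by its order, so that no scalar
    multiplication on [Q] has to be exhibited. *)
Lemma abelem_Fp2_space (gT : finGroupType) (Q : {group gT}) m :
  p.-abelem Q -> #|Q| = (p ^ (2 * m))%N -> is_Fp2_space p Q.
Proof.
move=> abQ cQ; have [F pF cF] := pPrimePowerField pr_p (isT : 0 < 2).
exists F, 'rV[F]_m; split=> //.
rewrite (isog_abelem_card _ abQ) fin_lmod_pchar_abelem //.
by rewrite cardsT card_mx cF mul1n cQ -expnM eqxx.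
Qed.

(** The filtration consists of the subgroups of [p ^ k]-th powers, in increasing
    order. In additive terms [G] is a module over the Gaussian integers, with
    [f] as multiplication by a square root of [-1], and these are the submodules
    [p ^ k * G], which [f] preserves. *)
Lemma Fp2_filtration_sqrtN1 (gT : finGroupType) (G : {group gT})
    (f : gT -> gT) :
    p.-group G -> abelian G -> {in G, forall x, f x \in G} ->
    {in G &, {morph f : x y / x * y}} -> {in G, forall x, f (f x) = x^-1} ->
  has_Fp2_filtration p G.
Proof.
move=> pG cGG fG fM f2; have [n expG] := p_natP (pnat_dvd (exponent_dvdn G) pG).
have f1 : f 1 = 1 by apply: (mulgI (f 1)); rewrite -fM // !mulg1.
have fX k : {in G, {morph f : x / x ^+ k}}.
  by move=> x Gx; elim: k => // k IHk; rewrite !expgS fM ?groupX // IHk.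
have MhoE k := MhoEabelian k pG cGG.
have cMho k : exists m, #|'Mho^k(G)| = (p ^ (2 * m))%N.
  apply: (card_pgroup_sqrtN1 (f := f)); first exact: pgroupS (Mho_sub _ _) pG.
    move=> x; rewrite /= MhoE => /imsetP[y Gy ->]; rewrite fX //.
    by apply/imsetP; exists (f y); rewrite ?fG.
  by move=> x /(subsetP (Mho_sub _ _)); exact: f2.
exists n, (fun i => 'Mho^(n - i)(G)%G); split=> /=.
- apply/trivgP/subsetP=> x; rewrite /= subn0 MhoE => /imsetP[y Gy ->].
  by rewrite -expG expg_exponent // inE.
- by rewrite subnn Mho0.
move=> i lt_in; rewrite -(subnSK lt_in); set k := (n - i.+1)%N.
have sMho := Mho_leq G (leqnSn k).
have cMM: abelian 'Mho^k(G) := abelianS (Mho_sub _ _) cGG.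
have nMho : 'Mho^k.+1(G) <| 'Mho^k(G) by rewrite -sub_abelian_normal.
split=> //.
have abQ : p.-abelem ('Mho^k(G) / 'Mho^k.+1(G)).
  apply/abelemP=> //; split; first exact: quotient_abelian.
  move=> _ /morphimP[x Nx Mx ->]; rewrite -morphX //; apply: coset_id.
  move: Mx; rewrite /= !MhoE => /imsetP[y Gy ->].
  by apply/imsetP; exists y; rewrite // -expgM -expnSr.
have [m1 c1] := cMho k; have [m2 c2] := cMho k.+1.
apply: (abelem_Fp2_space (m := (m1 - m2)%N) abQ).
rewrite card_quotient ?normal_norm // -divgS //= c1 c2 mulnBr expnB //.
  exact: prime_gt0.
rewrite -(leq_exp2l _ _ (prime_gt1 pr_p)) -c1 -c2 /=.
exact: subset_leq_card.
Qed.

End InertPrime.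

(** * A square root of -1 *)

(** By uniqueness of the decomposition, each component of [u] is of order at most
    2 in its cyclic factor; as 4 divides the order of the generator, it is an
    even power of this generator. *)
Lemma bigdprod_sqrt (gT : finGroupType) (s : nat) (x : 'I_s -> gT)
    (G : {group gT}) (u : gT) :
    abelian G -> (\big[dprod/1]_(i < s) <[x i]>)%g = G ->
    (forall i, 4 %| #[x i]) -> u \in G -> u ^+ 2 = 1 ->
  exists2 v, v \in G & u = v ^+ 2.
Proof.
move=> cGG defG x4 Gu u2; have [c [cP uE _]] := mem_bigdprod defG Gu.
have sxG i : <[x i]> \subset G.
  by rewrite -(bigdprodWY defG) sub_gen // (bigcup_sup i).
have Gc i : c i \in G by exact: subsetP (sxG i) _ (cP i isT).
have prodX (d : 'I_s -> gT) : (forall i, d i \in G) ->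
    (\prod_i d i) ^+ 2 = \prod_i (d i ^+ 2).
  move=> Gd; pose P y z := z \in G /\ z ^+ 2 = y.
  (* Membership in the abelian group [G] is carried along the induction. *)
  suff [] : P (\prod_i d i ^+ 2) (\prod_i d i) by [].
  elim/big_ind2: _ => [|y1 z1 y2 z2 [G1 <-] [G2 <-]|i _]; split=> //.
  - by rewrite expg1n.
  - by rewrite groupM.
  by rewrite expgMn //; apply: (centsP cGG).
have c2 i : c i ^+ 2 = 1.
  have [d [_ _ dU]] := mem_bigdprod defG (group1 G).
  rewrite (dU (fun i => c i ^+ 2)) // => [|j _|].
  - by apply/esym/dU; rewrite ?group1 ?big1_eq.
  - exact/groupX/cP.
  by rewrite -prodX // -uE.
have /fin_all_exists2[d Gd cE] i : exists2 d, d \in G & c i = d ^+ 2.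
  have /cycleP[k cE] := cP i isT; exists (x i ^+ k./2).
    by rewrite groupX // (subsetP (sxG i)) ?cycle_id.
  have /even_halfK k2 : ~~ odd k.
    have := c2 i; rewrite cE -expgM => /eqP; rewrite -order_dvdn.
    by move/(dvdn_trans (x4 i)); rewrite (@dvdn_pmul2r 2 2) // dvdn2.
  by rewrite cE -expgM muln2 k2.
exists (\prod_i d i); first exact: group_prod.
by rewrite prodX // uE; apply: eq_bigr.
Qed.

Section UnitsAndNilradical.
Variables (A : comUnitRingType) (finU : finitely_many_units A).

Lemma sqrtN1 : has_epsilon finU 2 -> exists i : A, (i * i = -1)%R.
Proof.
move=> [s [x [e [defO cx _ e2]]]].
have N1u : (-1 : A)%R \is a GRing.unit by rewrite unitrN1.
pose u : unit_group finU := UnitGroup finU N1u.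
have u2 : u ^+ 2 = 1 by apply: val_inj; rewrite /= mulN1r opprK.
have Ou : u \in 'O_2([set: unit_group finU]).
  rewrite (mem_Hall_pcore (unit_group_Sylow finU 2)) ?inE //.
  have : #[u] %| 2 by rewrite order_dvdn u2.
  by move/pnat_dvd; apply.
have [|v _ uv] := bigdprod_sqrt (unit_group_abelian _) defO _ Ou u2.
  by move=> i; have [-> _] := cx i; exact: (dvdn_exp2l 2 (e2 i)).
by exists (unit_val v); have := congr1 val uv.
Qed.

(** * The p-part of the nilradical and its powers *)

Local Notation N := (nilradical finU).
Local Notation U := (unit_group finU).

Lemma nil_valX (x : N) n : nil_val (x ^+ n) = (nil_val x *+ n)%R.
Proof. by elim: n => // n IHn; rewrite expgS mulrS -IHn. Qed.

(** An elementwise description, from which the ideal property is immediate. *)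
Lemma nilradical_pP p z : prime p ->
  nilradical_p finU p z <->
  z \in @nilpotent_elt A /\ exists k, (z *+ p ^ k)%R = 0%R.
Proof.
move=> pr_p; have inO (x : N) : x \in 'O_p([set: N]) = p.-elt x.
  by rewrite (mem_Hall_pcore (nilradical_Sylow finU p)) ?inE.
split=> [[x] | [nz [k zk]]].
  rewrite inO => /p_natP[k xk] <-; split; first exact: (valP x).
  by exists k; rewrite -xk -nil_valX expg_order.
exists (Nilradical finU nz) => //; rewrite inO.
have : #[Nilradical finU nz] %| p ^ k.
  by rewrite order_dvdn; apply/eqP/val_inj; rewrite /= nil_valX.
by move/pnat_dvd; apply; rewrite pnatX pnat_id.
Qed.

Section Ideal.
Variables (p : nat) (pr_p : prime p).
Local Notation I := (nilradical_p finU p).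

Lemma nilradical_p_mul (a z : A) : I z -> I (a * z)%R.
Proof.
move=> /(nilradical_pP _ pr_p)[/nilpotentP[n zn] [k zk]].
apply/nilradical_pP => //; split; last by exists k; rewrite -mulrnAr zk mulr0.
by apply/nilpotentP; exists n; rewrite exprMn zn mulr0.
Qed.

Lemma nilradical_p_sum n (z : 'I_n -> A) :
  (forall i, I (z i)) -> I (\sum_i z i)%R.
Proof.
move=> Iz; elim/big_ind: _ => // [|x y [x' Ox <-] [y' Oy <-]].
  by exists 1 => //; exact: group1.
by exists (x' * y') => //; exact: groupM.
Qed.

Lemma nilradical_p1 : ideal_pow I 1 = I.
Proof.
apply/funext=> z; apply/propext; split=> [[n [x [y [xy ->]]]]|Iz].
  apply: nilradical_p_sum => i; rewrite mulrC.
  exact/nilradical_p_mul/(xy i).1.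
exists 1%N, (fun=> z), (fun=> 1%R); split=> //.
by rewrite big_ord1 mulr1.
Qed.

Lemma ideal_powS_sub j x : ideal_pow I j.+1 x -> ideal_pow I j x.
Proof.
case=> [n [a [b [ab ->]]]]; elim/big_ind: _ => [||i _].
- exact: ideal_pow0.
- exact: ideal_powD.
exact/ideal_powM/(ab i).2.
Qed.

Lemma ideal_pow_sub1 j x : ideal_pow I j.+1 x -> I x.
Proof.
by elim: j => [|j IHj]; [rewrite nilradical_p1 | move/ideal_powS_sub].
Qed.

(** The exponent [j.+1] is positive, so [x] is in [I], and [I * I^(j+1)] is
    [I^(j+2)]. *)
Lemma ideal_pow_mul j x y :
  ideal_pow I j.+1 x -> ideal_pow I j.+1 y -> ideal_pow I j.+2 (x * y)%R.
Proof.
move=> /ideal_pow_sub1 Ix Iy; exists 1%N, (fun=> x), (fun=> y).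
by rewrite big_ord1.
Qed.

(** * The unit groups 1 + I^j *)

Lemma mem_one_plus (J : set A) u :
  u \in one_plus finU J <-> J (unit_val u - 1)%R.
Proof.
split=> [/one_plusP[x Jx ->]|Ju]; first by rewrite addrC addKr.
by apply/one_plusP; exists (unit_val u - 1)%R; rewrite // addrC subrK.
Qed.

Lemma card_one_plus : #|one_plus finU I| = #|'O_p([set: N])|.
Proof.
pose f (x : N) := UnitGroup finU (unit_1_nilpotent (valP x)).
have injf : injective f by move=> x y /(congr1 val)/addrI/val_inj.
rewrite -(card_imset _ injf); apply: eq_card => u.
apply/one_plusP/imsetP=> [[_ [x Ox <-] ux]|[x Ox ->]].
  by exists x => //; apply: val_inj.
by exists (nil_val x) => //; exists x.
Qed.

Lemma pgroup_one_plus j : p.-group (one_plus finU (ideal_pow I j.+1)).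
Proof.
apply: (pgroupS (G := one_plus_pow_group finU I 1)).
  apply/subsetP=> u /mem_one_plus /ideal_pow_sub1 Iu.
  by apply/mem_one_plus; rewrite nilradical_p1.
have cI : #|one_plus finU (ideal_pow I 1)| = #|'O_p([set: N])|.
  by rewrite nilradical_p1 card_one_plus.
by rewrite /pgroup [#|_|]cI; exact: pcore_pgroup.
Qed.

Lemma unit_normalises (H : {group U}) u : u \in 'N(H).
Proof.
apply: (subsetP (normal_norm _)) (in_setT u).
by rewrite -sub_abelian_normal ?subsetT //; exact: unit_group_abelian.
Qed.

(** * Multiplication by i on (1 + I^j) / (1 + I^(j+1)) *)

Section Quotient.
Variables (i : A) (i2 : (i * i = -1)%R) (j : nat).
Local Notation G1 := (one_plus_pow_group finU I j.+1).
Local Notation G2 := (one_plus_pow_group finU I j.+2).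

(** Equality in the quotient is congruence in [A], because
    [u / v - 1 = (u - v) / v]; this turns the statements below into ring
    identities. *)
Lemma coset_one_plusP (u v : U) :
  coset G2 u = coset G2 v <-> ideal_pow I j.+2 (unit_val u - unit_val v)%R.
Proof.
have eqc : reflect (coset G2 u = coset G2 v) (u * v^-1 \in G2).
  by rewrite -mem_rcoset; apply: rcoset_kercosetP; exact: unit_normalises.
have uvE : (unit_val (u * v^-1)%g - 1
    = (unit_val v)^-1 * (unit_val u - unit_val v))%R.
  by rewrite mulrBr mulVr ?(valP v) // mulrC.
split=> [/eqc /mem_one_plus | Juv].
  by move/(ideal_powM (unit_val v)); rewrite uvE mulVKr // (valP v).
by apply/eqc/mem_one_plus; rewrite uvE; exact: ideal_powM.
Qed.

(** The map [1 + x |-> 1 + i * x]; on [1 + I] the default is never taken, as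
    [i * x] is nilpotent there. *)
Definition twist (u : U) : U := insubd (1 : U) (1 + i * (unit_val u - 1))%R.

Lemma val_twist u :
  u \in G1 -> unit_val (twist u) = (1 + i * (unit_val u - 1))%R.
Proof.
move=> /mem_one_plus /ideal_pow_sub1 Iu; apply: insubdK.
by case: (nilradical_p_mul i Iu) => x _ <-; apply/unit_1_nilpotent/(valP x).
Qed.

Lemma twist_G1 u : u \in G1 -> twist u \in G1.
Proof.
move=> Gu; apply/mem_one_plus; rewrite val_twist // addrC addKr.
exact/ideal_powM/mem_one_plus.
Qed.

Lemma coset_twist u v : u \in G1 -> v \in G1 ->
  coset G2 u = coset G2 v -> coset G2 (twist u) = coset G2 (twist v).
Proof.
move=> Gu Gv /coset_one_plusP Juv; apply/coset_one_plusP.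
rewrite !val_twist // opprD addrACA subrr add0r -mulrBr opprB addrA subrK.
exact: ideal_powM.
Qed.

(** With [u = 1 + x] and [v = 1 + y], the two representatives differ by
    [(i - i * i) * (x * y)], a multiple of a product of two elements of
    [I^(j+1)]. *)
Lemma coset_twistM u v : u \in G1 -> v \in G1 ->
  coset G2 (twist (u * v)) = coset G2 (twist u * twist v).
Proof.
move=> Gu Gv; apply/coset_one_plusP.
have -> : unit_val (twist u * twist v)
  = (unit_val (twist u) * unit_val (twist v))%R by [].
rewrite !val_twist ?groupM //.
have -> : unit_val (u * v) = (unit_val u * unit_val v)%R by [].
set x := (unit_val u - 1)%R; set y := (unit_val v - 1)%R.
have -> : unit_val u = (1 + x)%R by rewrite addrC subrK.
have -> : unit_val v = (1 + y)%R by rewrite addrC subrK.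
have -> : (1 + i * ((1 + x) * (1 + y) - 1) - (1 + i * x) * (1 + i * y)
  = (i - i * i) * (x * y))%R by ring.
by apply/ideal_powM/ideal_pow_mul; apply/mem_one_plus.
Qed.

(** With [u = 1 + x] the left side is represented by [1 - x], and
    [(1 - x) - 1 / u = - (x * x) / u]. *)
Lemma coset_twist2 u : u \in G1 ->
  coset G2 (twist (twist u)) = coset G2 u^-1.
Proof.
move=> Gu; apply/coset_one_plusP; rewrite !val_twist ?twist_G1 //.
set x := (unit_val u - 1)%R.
have -> : unit_val (u^-1) = (unit_val u)^-1%R by [].
set w := (_^-1)%R.
have xw : ((1 + x) * w = 1)%R by rewrite addrC subrK divrr ?(valP u).
have -> : (1 + i * (1 + i * x - 1) - w
  = - w * (x * x) + (1 - x) * (1 - (1 + x) * w) + (i * i + 1) * x)%R by ring.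
rewrite xw i2 subrr mulr0 addNr mul0r !addr0.
by apply/ideal_powM/ideal_pow_mul; apply/mem_one_plus.
Qed.

Lemma one_plus_quotient_filtration : p = 3 %[mod 4] ->
  has_Fp2_filtration p
    (one_plus finU (ideal_pow I j.+1) / one_plus finU (ideal_pow I j.+2)).
Proof.
move=> p3; pose phi (C : coset_of G2) := coset G2 (twist (repr C)).
have sG21 : G2 \subset G1.
  by apply/subsetP=> u /mem_one_plus /ideal_powS_sub Ju; apply/mem_one_plus.
have reprG1 C : C \in G1 / G2 -> repr C \in G1.
  case/morphimP=> u Nu Gu ->; have := mem_repr_coset (coset G2 u).
  rewrite val_coset // => /rcosetP[w /(subsetP sG21) Gw ->].
  by rewrite groupM.
have phiE u : u \in G1 -> phi (coset G2 u) = coset G2 (twist u).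
  move=> Gu; apply: coset_twist => //; last by rewrite coset_reprK.
  by apply/reprG1/mem_quotient.
apply: (@Fp2_filtration_sqrtN1 _ pr_p p3 _ (G1 / G2)%G phi).
- exact/quotient_pgroup/pgroup_one_plus.
- exact/quotient_abelian/unit_group_abelian.
- by move=> C /reprG1 GC; apply/mem_quotient/twist_G1.
- move=> _ _ /morphimP[u Nu Gu ->] /morphimP[v Nv Gv ->].
  rewrite -morphM // !phiE ?groupM //= coset_twistM //.
  by rewrite morphM //; exact: unit_normalises.
move=> _ /morphimP[u Nu Gu ->].
rewrite [phi (coset_morphism G2 u)]phiE // phiE ?twist_G1 //.
rewrite coset_twist2 //; exact: (morphV (coset_morphism G2) Nu).
Qed.

End Quotient.

(** * The order of 1 + I *)

(** Counted in the additive group of [I], on which [i] acts by multiplication. *)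
Lemma card_one_plus_square (i : A) : (i * i = -1)%R -> p = 3 %[mod 4] ->
  exists m, #|one_plus finU I| = (m ^ 2)%N.
Proof.
move=> i2 p3; have nilM (x : N) : (i * nil_val x)%R \in @nilpotent_elt A.
  have /nilpotentP[n xn] := valP x; apply/nilpotentP; exists n.
  by rewrite exprMn xn mulr0.
pose f x : N := Nilradical finU (nilM x).
case: (@card_pgroup_sqrtN1 p p3 _ 'O_p([set: N])%G f).
- exact: pcore_pgroup.
- move=> x Ox; have Ifx : I (i * nil_val x)%R.
    by apply: nilradical_p_mul; exists x.
  by case: Ifx => y Oy yE; rewrite (_ : f x = y) //; apply: val_inj.
- by move=> x _; apply: val_inj; rewrite /= mulrA i2 mulN1r.
by move=> m cO; exists (p ^ m)%N; rewrite card_one_plus [LHS]cO -expnM mulnC.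
Qed.

End Ideal.
End UnitsAndNilradical.

Theorem proposition5p13 (A : comUnitRingType) (finU : finitely_many_units A)
    (p : nat) (heps : has_epsilon finU 2) (pr_p : prime p)
    (hp : p = 3 %[mod 4]) :
  (forall j : nat, (1 <= j)%N ->
     has_Fp2_filtration p
       (one_plus finU (ideal_pow (nilradical_p finU p) j)
        / one_plus finU (ideal_pow (nilradical_p finU p) j.+1)))
  /\ exists m : nat, #|one_plus finU (nilradical_p finU p)| = (m ^ 2)%N.
Proof.
have [i i2] := sqrtN1 heps; split.
  by case=> // j _; exact: (one_plus_quotient_filtration finU pr_p i2).
exact: (card_one_plus_square finU pr_p i2).
Qed.
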